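(* Let $(V,\omega)$ be a weak symplectic vector space, $C\subseteq V$ a split coisotropic subspace, and $L\subseteq V$ a split Lagrangian subspace which intersects $C$ neatly. Then the reduction $\underline L=(L\cap C)/(L\cap C^\omega)\subseteq\underline C$ is a split Lagrangian subspace of $\underline C$.
   Context: All vector spaces are real topological vector spaces, and $V^*$ denotes the space of continuous linear functionals on $V$. A weak symplectic vector space is a space $V$ with a skew-symmetric bilinear form $\omega$ such that $\omega^\sharp(v)=\omega(v,\cdot)$ defines an injective linear map $\omega^\sharp:V\to V^*$. For a subspace $W$, $W^\omega=\{v\in V:\omega(v,w)=0\ \forall w\in W\}$. A subspace $L$ is isotropic if $L\subseteq L^\omega$, coisotropic if $L^\omega\subseteq L$, Lagrangian if $L=L^\omega$, and split Lagrangian if it is Lagrangian and has a Lagrangian complement; a pair $(L,L')$ of Lagrangian subspaces with $V=L\oplus L'$ is a splitting l-pair. For $C$ coisotropic, $\underline C=C/C^\omega$ carries the form $\underline\omega([x],[y])=\omega(x,y)$, and $\underline L$ is regarded as the image of $L\cap C$ in $\underline C$. A coisotropic subspace $C$ is split coisotropic if there are a complement $C^c$ to $C$ in $V$ and a complement $C'$ to $C^\omega$ in $C$ such that $C^c$ is isotropic and $C'$, $C^c$ are symplectically orthogonal; then $(C,C^c,C')$ is called a splitting c-triple. A splitting l-pair $(L,L')$ and $C$ intersect neatly if, for a splitting c-triple $(C,C^c,C')$, one has $C'=(L\cap C')+(L'\cap C')$. A split Lagrangian $L$ intersects $C$ neatly if this holds for some splitting l-pair $(L,L')$ and some splitting c-triple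 $(C,C^c,C')$. *)

(* Defs.v *)
From HB Require Import structures.
From mathcomp Require Import all_boot all_order all_algebra.
From mathcomp Require Import all_classical all_reals all_analysis.

Set Implicit Arguments.
Unset Strict Implicit.
Unset Printing Implicit Defensive.

Import Order.TTheory GRing.Theory Num.Theory.
Import numFieldNormedType.Exports.

Local Open Scope classical_set_scope.
Local Open Scope ring_scope.
Local Open Scope quotient_scope.

(* A real topological vector space is a [topologicalLmodType R] with
   [R : realType] (no local convexity); a linear subspace is a
   [submodClosed V]. *)

Section Subspace.
Context {R : realType} {V : topologicalLmodType R}.

Definition subspace_of (W : submodClosed V) : Type := {x : V | x \in W}.

Variable W : submodClosed V.
Local Notation S := (subspace_of W).

HB.instance Definition _ := SubChoice.copy S {x : V | x \in W}.
HB.instance Definition _ := [SubChoice_isSubLmodule of S by <:].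
HB.instance Definition _ :=
  Topological.copy S (initial_topology (val : S -> V)).

Lemma subspace_val_continuous : continuous (val : S -> V).
Proof. exact: (@initial_continuous S V val). Qed.

Lemma subspace_add_continuous : continuous (fun z : S * S => z.1 + z.2).
Proof.
apply: (@continuous_comp_initial S (S * S)%type V val) => z.
have -> : val \o (fun z : S * S => z.1 + z.2) =
          (fun z : S * S => val z.1 + val z.2) by apply/funext.
apply: (@continuous_comp _ (V * V)%type _
  (fun z : S * S => (val z.1, val z.2)) (fun w => w.1 + w.2)); last first.
  exact: add_continuous.
apply: cvg_pair => /=.
  by apply: continuous_comp; [exact: cvg_fst|exact: subspace_val_continuous].
by apply: continuous_comp; [exact: cvg_snd|exact: subspace_val_continuous].
Qed.

Lemma subspace_scale_continuous : continuous (fun z : R^o * S => z.1 *: z.2).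
Proof.
apply: (@continuous_comp_initial S (R^o * S)%type V val) => z.
have -> : val \o (fun z : R^o * S => z.1 *: z.2) =
          (fun z : R^o * S => z.1 *: val z.2) by apply/funext.
apply: (@continuous_comp _ (R^o * V)%type _
  (fun z : R^o * S => (z.1, val z.2)) (fun w => w.1 *: w.2)); last first.
  exact: scale_continuous.
apply: (@cvg_pair _ _ _ _ (nbhs (z.1 : R^o))) => /=; first exact: cvg_fst.
by apply: continuous_comp; [exact: cvg_snd|exact: subspace_val_continuous].
Qed.

HB.instance Definition _ :=
  PreTopologicalNmodule_isTopologicalNmodule.Build S subspace_add_continuous.
HB.instance Definition _ :=
  TopologicalNmodule_isTopologicalLmodule.Build R S subspace_scale_continuous.

End Subspace.

Section Quotient.
Context {R : realType} {V : topologicalLmodType R}.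

(* Library quotients are indexed by [zmodClosed]; a [submodClosed] is one,
   but the library does not declare it. *)
Definition zmod_of (W : submodClosed V) : zmodClosed V :=
  HB.pack (fun x => x \in W)
    (GRing.isSubmodClosed.Build R V (fun x => x \in W) (submodClosedP W)).

Definition quotient_of (W : submodClosed V) : Type :=
  Quotient.quot (zmod_of W).

Variable W : submodClosed V.
Local Notation Q := (quotient_of W).

HB.instance Definition _ := GRing.Zmodule.copy Q (Quotient.quot (zmod_of W)).
Definition quotient_pi : V -> Q := \pi_(Quotient.quot (zmod_of W)).

(* The topology of [quotient_topology], which cannot be copied to [Q]: its
   choice structure is not the one of [Quotient.quot]. *)
Definition quotient_of_open : set_system Q :=
  [set U | open (quotient_pi @^-1` U)].

Let openT_ : quotient_of_open setT.
Proof. by rewrite /quotient_of_open /= preimage_setT; exact: openT. Qed.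
Let openI_ : setI_closed quotient_of_open.
Proof. by move=> A B oA oB; apply: openI. Qed.
Let open_bigU_ (I : Type) (f : I -> set Q) :
  (forall i, quotient_of_open (f i)) -> quotient_of_open (\bigcup_i f i).
Proof.
by move=> of_; apply: (@bigcup_open V) => i _; exact: of_.
Qed.
HB.instance Definition _ := isOpenTopological.Build Q openT_ openI_ open_bigU_.

Definition quotient_repr : Q -> V := @repr _ (Quotient.quot (zmod_of W)).

Lemma quotient_reprK : cancel quotient_repr quotient_pi.
Proof. exact: (@reprK _ (Quotient.quot (zmod_of W))). Qed.

Lemma quotient_piE x y : quotient_pi x = quotient_pi y <-> x - y \in W.
Proof.
by rewrite (_ : (x - y \in W) = (x - y \in zmod_of W))// Quotient.idealrBE;
   split=> /eqP.
Qed.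

Lemma quotient_piD x y : quotient_pi (x + y) = quotient_pi x + quotient_pi y.
Proof. exact: Quotient.pi_add. Qed.

Definition quotient_scale (a : R) (q : Q) : Q :=
  quotient_pi (a *: quotient_repr q).

Lemma quotient_piZ a x : quotient_pi (a *: x) = quotient_scale a (quotient_pi x).
Proof.
apply/quotient_piE; rewrite -scalerBr rpredZ//.
by apply/quotient_piE; rewrite quotient_reprK.
Qed.

Let scaleA a b q :
  quotient_scale a (quotient_scale b q) = quotient_scale (a * b) q.
Proof. by rewrite -(quotient_reprK q) -!quotient_piZ scalerA. Qed.
Let scale1 : left_id 1 quotient_scale.
Proof. by move=> q; rewrite -(quotient_reprK q) -!quotient_piZ scale1r. Qed.
Let scaleDr : right_distributive quotient_scale +%R.
Proof.
move=> a q r; rewrite -(quotient_reprK q) -(quotient_reprK r).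
by rewrite -quotient_piD -!quotient_piZ scalerDr quotient_piD.
Qed.
Let scaleDl q : {morph quotient_scale^~ q : a b / a + b}.
Proof.
move=> a b; rewrite -(quotient_reprK q).
by rewrite -!quotient_piZ scalerDl quotient_piD.
Qed.

HB.instance Definition _ :=
  GRing.Zmodule_isLmodule.Build R Q scaleA scale1 scaleDr scaleDl.

Lemma quotient_pi_linear : linear quotient_pi.
Proof. by move=> a x y; rewrite quotient_piD quotient_piZ. Qed.
HB.instance Definition _ :=
  GRing.isLinear.Build R V Q *:%R quotient_pi quotient_pi_linear.

Lemma quotient_pi_continuous : continuous quotient_pi.
Proof. exact/continuousP. Qed.

Lemma quotient_pi_nbhs x (U : set V) :
  nbhs x U -> nbhs (quotient_pi x) (quotient_pi @` U).
Proof.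
rewrite topology_structure.nbhsE => -[A [oA Ax] AU].
rewrite topology_structure.nbhsE.
exists (quotient_pi @` A); last exact: image_subset.
split; last by exists x.
change (open (quotient_pi @^-1` (quotient_pi @` A))).
rewrite openE => y [z Az /quotient_piE zy].
have : nbhs (y + (z - y)) A by rewrite addrC subrK; exact: open_nbhs_nbhs.
have /(_ y) sc : continuous (fun t : V => t + (z - y)).
  move=> t; apply: (@continuous_comp _ (V * V)%type _
    (fun t : V => (t, z - y)) (fun w => w.1 + w.2)); last exact: add_continuous.
  by apply: (@cvg_pair _ _ _ _ (nbhs t)) => /=; [exact: cvg_id|exact: cvg_cst].
move=> /sc sA; rewrite /interior.
apply: (@filterS V (nbhs y) _ _ _ _ sA) => t At; exists (t + (z - y)) => //.
by apply/quotient_piE; rewrite addrAC subrr add0r.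
Qed.

Lemma quotient_add_continuous : continuous (fun z : Q * Q => z.1 + z.2).
Proof.
move=> [q r] U /=; rewrite -(quotient_reprK q) -(quotient_reprK r).
rewrite -quotient_piD => /quotient_pi_continuous.
move=> /(@add_continuous V (_, _))[[A B] /= [nA nB] AB].
exists (quotient_pi @` A, quotient_pi @` B) => /=.
  by split; exact: quotient_pi_nbhs.
move=> [s t] /= [[a Aa <-] [b Bb <-]]; rewrite -quotient_piD.
exact: (AB (a, b)).
Qed.

Lemma quotient_scale_continuous : continuous (fun z : R^o * Q => z.1 *: z.2).
Proof.
move=> [a q] U /=; rewrite -(quotient_reprK q) -linearZ.
move=> /quotient_pi_continuous.
move=> /(@scale_continuous R V (_, _))[[A B] /= [nA nB] AB].
exists (A, quotient_pi @` B) => /=; first by split=> //; exact: quotient_pi_nbhs.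
move=> [b t] /= [Ab [x Bx <-]]; rewrite -linearZ.
exact: (AB (b, x)).
Qed.

HB.instance Definition _ :=
  PreTopologicalNmodule_isTopologicalNmodule.Build Q quotient_add_continuous.
HB.instance Definition _ :=
  TopologicalNmodule_isTopologicalLmodule.Build R Q quotient_scale_continuous.

End Quotient.

Section WeakSymplectic.
Context {R : realType}.

Definition continuous_dual (V : topologicalLmodType R) : set (V -> R^o) :=
  [set f | linear f /\ continuous f].

(* The curried form [v |-> omega v] is the map omega^sharp. *)
Record weak_symplectic (V : topologicalLmodType R) := WeakSymplectic {
  symplectic_form :> {biscalar V};
  symplectic_skew : forall u v, symplectic_form u v = - symplectic_form v u;
  symplectic_dual : forall v, continuous_dual (symplectic_form v : V -> R^o);
  symplectic_inj : injective (symplectic_form : V -> (V -> R))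
}.

End WeakSymplectic.

Section Subspaces.
Context {R : realType} {V : topologicalLmodType R} (omega : weak_symplectic V).

Definition orth_pred (W : {pred V}) : V -> bool :=
  fun v => `[< forall w, w \in W -> omega v w = 0 >].

Lemma orth_submod_closed W : GRing.submod_closed (orth_pred W).
Proof.
split=> [|a u v]; rewrite /in_mem /=.
  by apply/asboolP => w _; rewrite linear0l.
move=> /asboolP u0 /asboolP v0; apply/asboolP => w wW.
by rewrite linearPl u0// v0// mulr0 addr0.
Qed.

Definition orth (W : {pred V}) : submodClosed V :=
  HB.pack (orth_pred W)
    (GRing.isSubmodClosed.Build R V (orth_pred W) (orth_submod_closed W)).

Lemma orthP (W : {pred V}) v :
  reflect (forall w, w \in W -> omega v w = 0) (v \in orth W).
Proof. exact: asboolP. Qed.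

(* W = A + B, and W = A (+) B as an algebraic direct sum. *)
Definition is_sum (W A B : {pred V}) : Prop :=
  forall v, v \in W <-> exists2 a, a \in A & exists2 b, b \in B & v = a + b.

Definition is_direct_sum (W A B : {pred V}) : Prop :=
  is_sum W A B /\ (forall v, v \in A -> v \in B -> v = 0).

Definition isotropic (L : submodClosed V) : Prop := {subset L <= orth L}.

Definition coisotropic (C : submodClosed V) : Prop := {subset orth C <= C}.

Definition lagrangian (L : submodClosed V) : Prop := L =i orth L.

Definition splitting_lpair (L L' : submodClosed V) : Prop :=
  [/\ lagrangian L, lagrangian L' & is_direct_sum predT L L'].

Definition split_lagrangian (L : submodClosed V) : Prop :=
  exists L' : submodClosed V, splitting_lpair L L'.

Definition splitting_ctriple (C Cc C' : submodClosed V) : Prop :=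
  [/\ coisotropic C,
      is_direct_sum predT C Cc,
      is_direct_sum C (orth C) C',
      isotropic Cc &
      forall x y, x \in C' -> y \in Cc -> omega x y = 0].

Definition split_coisotropic (C : submodClosed V) : Prop :=
  exists Cc C' : submodClosed V, splitting_ctriple C Cc C'.

Definition lpair_intersects_neatly (L L' C : submodClosed V) : Prop :=
  exists Cc C' : submodClosed V,
    splitting_ctriple C Cc C' /\
    is_sum C' [predI L & C'] [predI L' & C'].

Definition intersects_neatly (L C : submodClosed V) : Prop :=
  exists L' : submodClosed V,
    splitting_lpair L L' /\ lpair_intersects_neatly L L' C.

End Subspaces.

Section Reduction.
Context {R : realType} {V : topologicalLmodType R} (omega : weak_symplectic V).
Variable C : submodClosed V.
Local Notation S := (subspace_of C).

Definition reduction_kernel_pred : S -> bool := fun x => val x \in orth omega C.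

Lemma reduction_kernel_submod_closed :
  GRing.submod_closed reduction_kernel_pred.
Proof.
split=> [|a x y]; rewrite /in_mem /= /reduction_kernel_pred.
  by rewrite raddf0 rpred0.
by move=> xC yC; rewrite linearP; exact: (submodClosedP (orth omega C)).2.
Qed.

Definition reduction_kernel : submodClosed S :=
  HB.pack reduction_kernel_pred
    (GRing.isSubmodClosed.Build R S reduction_kernel_pred
       reduction_kernel_submod_closed).

(* C / (C :&: C^omega), hence C / C^omega when C is coisotropic. *)
Definition reduced_space : topologicalLmodType R :=
  quotient_of reduction_kernel.

Definition reduced_pi : S -> reduced_space := @quotient_pi _ _ reduction_kernel.

HB.instance Definition _ :=
  GRing.isLinear.Build R S reduced_space *:%R reduced_pi
    (@quotient_pi_linear _ _ reduction_kernel).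

Definition reduced_form (q r : reduced_space) : R :=
  omega (val (quotient_repr q)) (val (quotient_repr r)).

Let omega_kernel (x y : S) : x \in reduction_kernel ->
  omega (val x) (val y) = 0.
Proof. by move=> /orthP; apply; exact: valP. Qed.

Lemma reduced_formE (x y : S) :
  reduced_form (reduced_pi x) (reduced_pi y) = omega (val x) (val y).
Proof.
rewrite /reduced_form; set x' := quotient_repr _; set y' := quotient_repr _.
have xx' : x' - x \in reduction_kernel.
  by apply/quotient_piE; rewrite quotient_reprK.
have yy' : y' - y \in reduction_kernel.
  by apply/quotient_piE; rewrite quotient_reprK.
have /eqP := omega_kernel y' xx'; rewrite linearB /= linearBl subr_eq0 => /eqP ->.
have /eqP := omega_kernel x yy'; rewrite linearB /= linearBl subr_eq0 => /eqP yy.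
by rewrite symplectic_skew yy -symplectic_skew.
Qed.

Lemma reduced_form_bilinear : bilinear_for *%R *%R reduced_form.
Proof.
split=> u a q r; rewrite -(quotient_reprK u) -(quotient_reprK q);
  rewrite -(quotient_reprK r) -linearP !reduced_formE !linearP /=.
  by rewrite linearPl.
by [].
Qed.
HB.instance Definition _ :=
  bilinear_isBilinear.Build R reduced_space reduced_space R *%R *%R
    reduced_form reduced_form_bilinear.

Lemma reduced_form_skew q r : reduced_form q r = - reduced_form r q.
Proof. exact: symplectic_skew. Qed.

Lemma reduced_form_dual q : continuous_dual (reduced_form q : reduced_space -> R^o).
Proof.
split; first by move=> a r s; rewrite (reduced_form_bilinear.2 q).
rewrite -(quotient_reprK q); apply/continuousP => A oA.
suff : open [set x : S | A (omega (val (quotient_repr q)) (val x))].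
  congr open; apply/funext => x /=.
  by rewrite -[in LHS]reduced_formE.
have c : continuous (omega (val (quotient_repr q)) \o (val : S -> V) : S -> R^o).
  move=> x; apply: continuous_comp; first exact: subspace_val_continuous.
  exact: (symplectic_dual omega _).2.
by move/continuousP : c => /(_ A oA).
Qed.

Lemma reduced_form_inj : injective (reduced_form : _ -> (_ -> R)).
Proof.
move=> q r qr; rewrite -(quotient_reprK q) -(quotient_reprK r).
apply/quotient_piE/orthP => w wC.
have := congr1 (fun f => f (reduced_pi (Sub w wC))) qr.
rewrite -{1}(quotient_reprK q) -{1}(quotient_reprK r) !reduced_formE SubK.
by rewrite linearB /= linearBl => ->; rewrite subrr.
Qed.

Definition reduced_symplectic : weak_symplectic reduced_space :=
  WeakSymplectic (reduced_form_skew) reduced_form_dual reduced_form_inj.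

Variable L : submodClosed V.

Definition reduction_pred : reduced_space -> bool :=
  fun q => `[< exists2 x : S, val x \in L & reduced_pi x = q >].

Lemma reduction_submod_closed : GRing.submod_closed reduction_pred.
Proof.
split=> [|a q r]; rewrite /in_mem /=.
  by apply/asboolP; exists 0; rewrite ?raddf0 ?rpred0.
move=> /asboolP[x xL <-] /asboolP[y yL <-]; apply/asboolP.
by exists (a *: x + y); rewrite linearP //= rpredD// rpredZ.
Qed.

(* The image of L :&: C in C / C^omega. *)
Definition reduction : submodClosed reduced_space :=
  HB.pack reduction_pred
    (GRing.isSubmodClosed.Build R reduced_space reduction_pred
       reduction_submod_closed).

End Reduction.

(* Main.v *)
Require Import Defs.
From HB Require Import structures.
From mathcomp Require Import all_boot all_order all_algebra.
From mathcomp Require Import all_classical all_reals all_analysis.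

(** Isotropic subspaces spanning a weak symplectic space form a splitting
    l-pair, because a vector orthogonal to both of them vanishes. The images of
    [L] and [L'] in [C / C^omega] are isotropic, and neatness makes them span it:
    [C = C^omega + C'] and [C' = (L :&: C') + (L' :&: C')]. *)

Set Implicit Arguments.
Unset Strict Implicit.
Unset Printing Implicit Defensive.

Import GRing.Theory.
Local Open Scope ring_scope.

Section IsotropicPair.
Context {R : realType} {V : topologicalLmodType R} (omega : weak_symplectic V).
Implicit Types A B : submodClosed V.

Lemma symplectic_nondegenerate v : (forall w, omega v w = 0) -> v = 0.
Proof.
move=> v0; apply: (@symplectic_inj _ _ omega); apply/funext => w.
by rewrite v0 linear0l.
Qed.

Lemma is_sumC (W A B : {pred V}) : is_sum W A B -> is_sum W B A.
Proof.
move=> sAB v; split=> [/sAB[a aA [b bB ->]]|[b bB [a aA ->]]].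
  by exists b => //; exists a => //; rewrite addrC.
by apply/sAB; exists a => //; exists b => //; rewrite addrC.
Qed.

Lemma orth_sum_eq0 A B v :
  is_sum predT A B -> v \in orth omega A -> v \in orth omega B -> v = 0.
Proof.
move=> sAB /orthP vA /orthP vB; apply: symplectic_nondegenerate => w.
have /sAB[a aA [b bB ->]] : w \in predT by [].
by rewrite linearD /= vA// vB// addr0.
Qed.

(** Write [x] orthogonal to [A] as [a + b]. Then [b = x - a] is orthogonal to [A], since [x] is and
    [A] is isotropic, and to [B], since [B] is isotropic; hence [b = 0]. *)
Lemma isotropic_sum_lagrangian A B :
  isotropic omega A -> isotropic omega B -> is_sum predT A B ->
  lagrangian omega A.
Proof.
move=> iA iB sAB x; apply/idP/idP => [/iA//|xA].
have /sAB[a aA [b bB xE]] : x \in predT by [].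
suff b0 : b = 0 by rewrite xE b0 addr0.
apply: (orth_sum_eq0 sAB); last exact: iB.
by rewrite -(addKr a b) -xE -scaleN1r rpredD ?rpredZ// iA.
Qed.

Lemma isotropic_sum_splitting_lpair A B :
  isotropic omega A -> isotropic omega B -> is_sum predT A B ->
  splitting_lpair omega A B.
Proof.
move=> iA iB sAB; split.
- exact: isotropic_sum_lagrangian iA iB sAB.
- exact: isotropic_sum_lagrangian iB iA (is_sumC sAB).
(* Isotropy puts a common vector of [A] and [B] in both orthogonals, so the sum is direct. *)
- by split=> // v /iA vA /iB vB; exact: orth_sum_eq0 sAB vA vB.
Qed.

Lemma lagrangian_isotropic A : lagrangian omega A -> isotropic omega A.
Proof. by move=> lA x; rewrite lA. Qed.

End IsotropicPair.

Section Reduction.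
Context {R : realType} {V : topologicalLmodType R} (omega : weak_symplectic V).
Variable C : submodClosed V.
Implicit Types L : submodClosed V.

Lemma reductionP L q :
  reflect (exists2 x : subspace_of C, val x \in L & reduced_pi omega x = q)
          (q \in reduction omega C L).
Proof. exact: asboolP. Qed.

(** Classes in the image have representatives in [L], and the reduced form can be evaluated on any
    representatives. *)
Lemma isotropic_reduction L :
  isotropic omega L ->
  isotropic (reduced_symplectic omega C) (reduction omega C L).
Proof.
move=> iL _ /reductionP[x xL <-]; apply/orthP => _ /reductionP[y yL <-].
by rewrite /= reduced_formE; move/orthP: (iL _ xL); exact.
Qed.

(** Dropping the component in [C^omega] of a representative does not change its class; the remaining
    component in [C'] splits along [L] and [L']. *)
Lemma reduction_sum L L' (C' : submodClosed V) :
  is_sum C (orth omega C) C' -> is_sum C' [predI L & C'] [predI L' & C'] ->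
  is_sum predT (reduction omega C L) (reduction omega C L').
Proof.
move=> sC sC' q; split=> // _.
(* Needed so that the summands [a] and [b] found below lie in [C] and have classes. *)
have C'C : {subset C' <= C}.
  move=> c cC'; apply/sC; exists 0; first exact: rpred0.
  by exists c; rewrite ?add0r.
rewrite -(quotient_reprK q); set x := quotient_repr q.
have /sC[k kC [c cC' xE]] := valP x.
have /sC'[a /andP[aL /C'C aC] [b /andP[bL' /C'C bC] cE]] := cC'.
exists (reduced_pi omega (Sub a aC)).
  by apply/reductionP; exists (Sub a aC); rewrite ?SubK.
exists (reduced_pi omega (Sub b bC)).
  by apply/reductionP; exists (Sub b bC); rewrite ?SubK.
rewrite -linearD /=; apply/quotient_piE.
(* The difference is exactly the component [k] of [x] in [C^omega]. *)
change (val (x - (Sub a aC + Sub b bC)) \in orth omega C).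
by rewrite linearB linearD /= xE cE -opprD addrK.
Qed.

End Reduction.

Theorem theorem3p10 (R : realType) (V : topologicalLmodType R)
    (omega : weak_symplectic V) (C L : submodClosed V)
    (hC : split_coisotropic omega C)
    (hL : split_lagrangian omega L)
    (hLC : intersects_neatly omega L C) :
  split_lagrangian (reduced_symplectic omega C) (reduction omega C L).
Proof.
case: hLC => L' [[lL lL' _] [Cc [C' [[_ _ [sC _] _ _] sC']]]].
(* The complement is the image of the [L'] along which neatness splits [C']. *)
exists (reduction omega C L'); apply: isotropic_sum_splitting_lpair.
- exact/isotropic_reduction/lagrangian_isotropic.
- exact/isotropic_reduction/lagrangian_isotropic.
- exact: reduction_sum sC sC'.
Qed.
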